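(* Let $G$ be a Polish group, let $\ell( * )<\omega$, and for each $\ell<\ell( * )$ let $n(\ell)<\omega$, let $A_\ell\in[\omega_1]^{\aleph_1}$, and let $(\bar{g}^\ell_\alpha : \alpha\in A_\ell)$ be a sequence with $\bar{g}^\ell_\alpha\in G^{n(\ell)}$ for all $\alpha\in A_\ell$. Let $\Delta$ be a finite set of quantifier-free formulas of the form $\varphi(\bar{x}^0,\ldots,\bar{x}^{\ell( * )-1})$ in the language of group theory, where $\bar{x}^\ell$ is a tuple of variables of length $n(\ell)$. Then there are $B_\ell\in[A_\ell]^{\aleph_1}$, for $\ell<\ell( * )$, and truth values $t_\varphi\in\{0,1\}$, for $\varphi\in\Delta$, such that for every $\varphi\in\Delta$ and every choice of $\alpha(\ell)\in B_\ell$, for $\ell<\ell( * )$, $$G\models\varphi^{t_\varphi}(\bar{g}^0_{\alpha(0)},\ldots,\bar{g}^{\ell( * )-1}_{\alpha(\ell( * )-1)}).$$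
   Context: For a set $X$, $[X]^{\aleph_1}$ denotes the set of subsets of $X$ of cardinality $\aleph_1$. For a formula $\varphi$ and a truth value $t\in\{0,1\}$, $\varphi^1$ is $\varphi$ and $\varphi^0$ is $\neg\varphi$. The language of group theory is $\{e,\cdot,(\ )^{-1}\}$. A Polish group is a topological group whose topology is separable and completely metrizable. *)

(* Defs.v *)
From HB Require Import structures.
From mathcomp Require Import all_boot all_order all_algebra.
From mathcomp Require Import all_classical all_reals all_analysis.
From mathcomp Require wochoice.

Set Implicit Arguments.
Unset Strict Implicit.
Unset Printing Implicit Defensive.

Import Order.TTheory GRing.Theory Num.Theory.

Local Open Scope classical_set_scope.

HB.mixin Record isTopologicalGroup G of Topological G & Group G := {
  mulg_continuous : continuous (fun xy : G * G => (xy.1 * xy.2)%g) ;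
  invg_continuous : continuous (fun x : G => (x^-1)%g)
}.

#[short(type="topologicalGroupType")]
HB.structure Definition TopologicalGroup :=
  {G of Topological G & Group G & isTopologicalGroup G}.

Definition separable (T : topologicalType) : Prop :=
  exists2 D : set T, countable D & dense D.

Record is_metric (R : realType) (T : Type) (d : T -> T -> R) : Prop := {
  metric_eq0 : forall x y, d x y = 0%R <-> x = y ;
  metric_symm : forall x y, d x y = d y x ;
  metric_tri : forall x y z, (d x z <= d x y + d y z)%R
}.

Definition metrizes (R : realType) (T : topologicalType) (d : T -> T -> R) :=
  forall (x : T) (U : set T),
    nbhs x U <-> exists2 e : R, (0 < e)%R & [set y | (d x y < e)%R] `<=` U.

Definition metric_cauchy (R : realType) (T : Type) (d : T -> T -> R)
    (u : nat -> T) :=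
  forall e : R, (0 < e)%R ->
    exists N : nat, forall i j : nat, N <= i -> N <= j -> (d (u i) (u j) < e)%R.

Definition completely_metrizable (R : realType) (T : topologicalType) :=
  exists d : T -> T -> R,
    [/\ is_metric d, metrizes d &
        forall u : nat -> T, metric_cauchy d u ->
          exists x : T, u @ \oo --> x].

Definition polish (R : realType) (T : topologicalType) :=
  separable T /\ completely_metrizable R T.

(** The ordinal omega_1, as the initial segment, in some well-ordering of
    the power set of nat, of the elements having countably many predecessors.
    [omega1_spec] below characterises it up to order isomorphism. *)

Definition powernat_le : rel (set nat) :=
  sval (wochoice.well_ordering_principle (set nat)).

Definition omega1 : Type :=
  {x : set nat | `[< countable [set y | powernat_le y x] >]}.

Definition omega1_le : rel omega1 := fun x y => powernat_le (sval x) (sval y).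

Lemma omega1_spec :
  [/\ wochoice.well_order omega1_le,
      ~ countable [set: omega1] &
      forall x : omega1, countable [set y | omega1_le y x] ].
Proof.
have wo : wochoice.well_order powernat_le.
  by rewrite /powernat_le; case: wochoice.well_ordering_principle.
have woT : wochoice.wo_chain powernat_le predT.
  by move=> A _; exact: wo.
have le_tot x y : powernat_le x y || powernat_le y x.
  by apply: (wochoice.wo_chainW woT).
have le_anti x y : powernat_le x y -> powernat_le y x -> x = y.
  move=> xy yx; apply: (wochoice.wo_chain_antisymmetric woT) => //.
  by rewrite xy yx.
have seg_countable (x : omega1) : countable [set y | omega1_le y x].
  case: x => x xP; have /asboolP cx := xP.
  move/countable_injP: cx => [f finj].
  apply/countable_injP; exists (f \o sval) => u v /set_mem ux /set_mem vx fuv.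
  by apply/val_inj/finj => //; rewrite inE.
split => // [|cW].
  apply: wochoice.antisymmetric_well_order.
    by move=> x y /andP[xy yx]; apply/val_inj; apply: le_anti.
  move=> A [a aA].
  have [|z [[/asboolP[u uA <-] zmin] _]] :=
      wo (fun x => `[< exists2 u, u \in A & sval u = x >]).
    by exists (sval a); apply/asboolP; exists a.
  by exists u; split => // v vA; apply: zmin; apply/asboolP; exists v.
pose C := [set x | countable [set y | powernat_le y x]].
have cC : countable C.
  have -> : C = range (fun w : omega1 => sval w).
    apply/seteqP; split => [x Cx|_ [w _ <-]]; last exact: (asboolW (svalP w)).
    have xP : `[< countable [set y | powernat_le y x] >] by exact/asboolP.
    by exists (exist _ x xP).
  exact: (card_le_trans (card_image_le _ _)).
have [x nCx] : exists x, ~ C x.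
  apply: contrapT => /forallNP CT.
  have : countable [set: set nat].
    by apply: sub_countable cC; apply: subset_card_le => x _; apply: contrapT.
  move/countable_injP => [f finj].
  pose D := [set n | exists2 X : set nat, f X = n & ~ X n].
  have nDD : ~ D (f D).
    move=> [X fXD nX]; apply: (nX); have -> : X = D by apply: finj; rewrite ?inE.
    by exists X.
  by apply: (nDD); exists D.
have [|m [[/asboolP nCm mmin] _]] := wo (fun x => `[< ~ C x >]).
  by exists x; apply/asboolP.
apply: nCm; apply: (@sub_countable _ _ _ (C `|` [set m])).
  apply: subset_card_le => y /= ym.
  have [Cy|nCy] := pselect (C y); [by left|right].
  by apply: le_anti => //; apply: mmin; apply/asboolP.
have -> : C `|` [set m] = \bigcup_(b in [set: bool]) (if b then C else [set m]).
  apply/seteqP; split => [y [Cy|ym]|y [[] _ ?]].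
  - by exists true.
  - by exists false.
  - by left.
  - by right.
by apply: bigcup_countable => // -[] _ //; exact: countable1.
Qed.

(** [X]^{aleph_1} *)
Definition aleph1_subsets (T : Type) (X : set T) : set (set T) :=
  [set B | B `<=` X /\ (B #= [set: omega1])%card].

(** Quantifier-free formulas in the language {e, ., ^-1} of groups, with
    variables in V *)

Inductive group_term (V : Type) : Type :=
| TVar of V
| TOne
| TMul of group_term V & group_term V
| TInv of group_term V.

Inductive qf_formula (V : Type) : Type :=
| FEq of group_term V & group_term V
| FNot of qf_formula V
| FAnd of qf_formula V & qf_formula V
| FOr of qf_formula V & qf_formula V
| FImp of qf_formula V & qf_formula V.

Fixpoint term_val (G : groupType) (V : Type) (e : V -> G)
    (s : group_term V) : G :=
  match s with
  | TVar v => e v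
  | TOne => 1%g
  | TMul s1 s2 => (term_val e s1 * term_val e s2)%g
  | TInv s1 => ((term_val e s1)^-1)%g
  end.

Fixpoint satisfies (G : groupType) (V : Type) (e : V -> G)
    (phi : qf_formula V) : Prop :=
  match phi with
  | FEq s1 s2 => term_val e s1 = term_val e s2
  | FNot p => ~ satisfies e p
  | FAnd p q => satisfies e p /\ satisfies e q
  | FOr p q => satisfies e p \/ satisfies e q
  | FImp p q => satisfies e p -> satisfies e q
  end.

(** phi^t *)
Definition fsign (V : Type) (phi : qf_formula V) (t : bool) : qf_formula V :=
  if t then phi else FNot phi.

(** Variables of (xbar^0, ..., xbar^(L-1)) with xbar^l of length n l:
    [Tagged _ i], for i : 'I_(n l), is the i-th variable of xbar^l. *)
Definition block_var (L : nat) (n : 'I_L -> nat) : Type :=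
  {l : 'I_L & 'I_(n l)}.

Definition block_val (G : Type) (L : nat) (n : 'I_L -> nat)
    (a : forall l, (n l).-tuple G) : block_var n -> G :=
  fun v => tnth (a (tag v)) (tagged v).

(* Main.v *)
Require Import Defs.
From mathcomp Require Import all_boot all_order all_algebra.
From mathcomp Require Import all_classical all_reals all_analysis.

(** All but countably many indices of an uncountable family in a
    second-countable space are condensation indices: every basic neighbourhood
    of their point contains the points of uncountably many indices.  The
    solution set of an equation is closed.  If some tuple of condensation
    indices violates the equation, then so does a whole box around it, and the
    traces of the box on the index sets are uncountable; otherwise the
    condensation indices themselves are homogeneous. *)

Import Order.TTheory GRing.Theory Num.Theory.

Local Open Scope classical_set_scope.

(** * Condensation elements *)

(** Each discarded element of [B] lies in some countable trace, and there are only countably many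
    traces. *)
Lemma uncountable_condensation {T : Type} {I : countType} (S : I -> set T)
    {B : set T} :
  ~ countable B ->
  ~ countable [set x | B x /\ forall i, S i x -> ~ countable (B `&` S i)].
Proof.
move=> nB; set C := (X in ~ countable X) => cC; apply: nB.
(* [D i] is the trace if that is countable and empty otherwise, hence countable for every [i]. *)
pose D i := [set x | (B `&` S i) x /\ countable (B `&` S i)].
have cD : countable (\bigcup_(i in [set: I]) D i).
  apply: bigcup_countable => [|i _]; first exact: countableP.
  have [c|nc] := pselect (countable (B `&` S i)).
    by apply: sub_countable c; apply: subset_card_le => x [].
  apply: (@sub_countable _ _ _ set0) => //.
  by apply: subset_card_le => x [_ /nc].
have cCD : countable (C `|` \bigcup_(i in [set: I]) D i).
  by rewrite -bigcup2E; apply: bigcup_countable => // -[|[|k]] _ //=.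
apply: sub_countable cCD; apply: subset_card_le => x Bx.
have [Cx|nCx] := pselect (C x); [by left|right].
have [i] : exists i, ~ (S i x -> ~ countable (B `&` S i)).
  by apply/existsNP => h; apply: nCx.
by move/not_implyP => [Six /contrapT ci]; exists i.
Qed.

(** * Uncountable subsets of omega_1 *)

Definition omega1_lt (x y : omega1) := omega1_le x y /\ x <> y.

Lemma omega1_wo_chain : wochoice.wo_chain omega1_le predT.
Proof. by have [wo _ _] := omega1_spec; move=> D _; exact: wo. Qed.

Lemma omega1_lt_wf : well_founded omega1_lt.
Proof.
have [wo _ _] := omega1_spec.
move=> x; apply: contrapT => nx.
have [|m [[/asboolP nm mmin] _]] := wo (fun y => `[< ~ Acc omega1_lt y >]).
  by exists x; apply/asboolP.
apply: nm; constructor => y [ym yNm]; apply: contrapT => ny; apply: yNm.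
apply: (wochoice.wo_chain_antisymmetric omega1_wo_chain) => //.
by rewrite ym mmin //; apply/asboolP.
Qed.

(** As initial segments are countable, a recursion along omega_1 never exhausts [B], so it injects
    omega_1 into [B]. *)
Lemma uncountable_omega1_card (B : set omega1) :
  ~ countable B -> (B #= [set: omega1])%card.
Proof.
move=> nB; rewrite card_eq_le (subset_card_le (@subsetT _ _)) /=.
have [_ _ seg] := omega1_spec.
have clt x : countable [set y | omega1_lt y x].
  by apply: sub_countable (seg x); apply: subset_card_le => y [].
(* Transfinite recursion: [f x] is an element of [B] outside the countable set
   of the values of [f] below [x]. *)
have pick x (h : forall y, omega1_lt y x -> omega1) :
    {z | B z /\ forall y (yx : omega1_lt y x), z <> h y yx}.
  apply: cid; apply: contrapT => /forallNP none; apply: nB.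
  (* [h'] makes [h] total, with default value [y], so that its values form the image of a countable
     set. *)
  pose h' y := if pselect (omega1_lt y x) is left yx then h y yx else y.
  apply: (@sub_countable _ _ _ (h' @` [set y | omega1_lt y x])); last first.
    exact: (card_le_trans (card_image_le _ _) (clt x)).
  apply: subset_card_le => z Bz; apply: contrapT => nz; apply: (none z).
  split=> // y yx zE; apply: nz; exists y => //.
  by rewrite /h'; case: pselect => // yx'; rewrite zE (Prop_irrelevance yx yx').
pose f := Fix omega1_lt_wf (fun _ => omega1) (fun x h => sval (pick x h)).
have fE x : f x = sval (pick x (fun y _ => f y)).
  rewrite /f Fix_eq // => y u v uv; congr (sval (pick y _)).
  by apply: functional_extensionality_dep => z; apply: funext => p.
have fB x : B (f x) by rewrite fE; case: (svalP (pick x (fun y _ => f y))).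
have f_lt x y : omega1_lt y x -> f x <> f y.
  move=> yx; rewrite fE.
  by case: (svalP (pick x (fun y _ => f y))) => _ /(_ y yx).
have finj : {in [set: omega1] &, injective f}.
  move=> x y _ _ fxy; apply: contrapT => xNy.
  have /orP[xy|yx] : omega1_le x y || omega1_le y x.
    exact: (wochoice.wo_chainW omega1_wo_chain).
  - by apply: (f_lt y x) => //; split.
  - by apply: (f_lt x y) => //; split => // /esym.
rewrite -(card_le_eql (inj_card_eq finj)).
by apply: subset_card_le => _ [x _ <-].
Qed.

(** * Metric spaces and continuity of terms *)

Lemma separable_metric_base {R : realType} {T : topologicalType}
    {d : T -> T -> R} :
  is_metric d -> metrizes d -> separable T ->
  exists b : nat -> set T, forall (x : T) (U : set T), nbhs x U ->
    exists k, b k x /\ b k `<=` U.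
Proof.
move=> [d0 dC dtri] dm [D cD dD]; have /countable_injP[f finj] := cD.
(* [p.1] codes the centre through [f], and [p.2] gives the radius 1/([p.2]+1). *)
pose b' (p : nat * nat) := [set y : T | exists q,
  [/\ D q, f q = p.1 & (d q y < p.2.+1%:R^-1)%R]].
exists (fun k => if unpickle k is Some p then b' p else set0) => x U.
move/dm => [e e0 eU].
(* With radius below [e / 2], a ball containing [x] stays within distance [e] of [x]. *)
have [k ke] : exists k : nat, (k.+1%:R^-1 < e / 2)%R.
  have e20 : (0 < e / 2)%R by rewrite divr_gt0.
  exists (Num.bound (e / 2)^-1)%R; rewrite invf_plt ?posrE //.
  apply: lt_trans (archi_boundP _) _; first by rewrite invr_ge0 ltW.
  by rewrite ltr_nat.
have nx : nbhs x [set y | (d x y < k.+1%:R^-1)%R].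
  by apply/dm; exists (k.+1%:R^-1)%R; rewrite ?invr_gt0.
have [q [/interior_subset /= xq Dq]] :=
    dD _ (ex_intro _ x nx) (@open_interior _ _).
exists (pickle (f q, k)); rewrite pickleK; split.
  by exists q; split => //=; rewrite dC.
move=> y [q' [/= Dq' fq' q'y]]; apply: eU => /=.
have qq' : q' = q by apply: finj; rewrite ?inE.
rewrite qq' in q'y; apply: le_lt_trans (dtri _ q _) _.
by rewrite [e]splitr ltrD // (lt_trans _ ke).
Qed.

Lemma metric_separation {R : realType} {T : topologicalType} {d : T -> T -> R} :
  is_metric d -> metrizes d -> forall {x y : T}, x <> y ->
  exists U W : set T, [/\ nbhs x U, nbhs y W & forall z, U z -> ~ W z].
Proof.
move=> [d0 dC dtri] dm x y xy.
have dxy0 : (0 < d x y)%R.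
  rewrite lt_neqAle eq_sym; apply/andP; split; first by apply/eqP => /d0.
  (* Nonnegativity follows from 0 = [d x x] <= [d x y + d y x] = 2 [d x y]. *)
  have := dtri x y x; rewrite (dC y x) (d0 x x).2 // -mulr2n.
  by rewrite pmulrn_lge0.
pose r := (d x y / 2)%R; have r0 : (0 < r)%R by rewrite divr_gt0.
exists [set z | (d x z < r)%R], [set z | (d y z < r)%R].
split => [||z /= xz yz]; [by apply/dm; exists r|by apply/dm; exists r|].
have := dtri x z y; rewrite (dC z y) leNgt => /negP; apply.
by rewrite [ltRHS]splitr ltrD.
Qed.

(** Continuity of term evaluation, stated with boxes; products intersect the boxes of their
    factors. *)
Lemma term_val_box {G : topologicalGroupType} {V : Type} {s : group_term V}
    {e : V -> G} {W : set G} :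
  nbhs (term_val e s) W ->
  exists U : V -> set G, (forall v, nbhs (e v) (U v)) /\
    forall e' : V -> G, (forall v, U v (e' v)) -> W (term_val e' s).
Proof.
elim: s W => [v||s IHs u IHu|s IHs] W /= We.
(* This box is [W] at coordinate [v] and the whole group at the others. *)
- exists (fun w => [set y | w = v -> W y]); split => [w|e' /(_ v)]; last exact.
  have [->|wv] := pselect (w = v); last by apply: nearW => y /wv.
  by apply: filterS We => y Wy.
- exists (fun=> setT); split => [v|e' _]; first exact: filterT.
  exact: nbhs_singleton.
- have [[W1 W2] /= [W1s W2u] W12] := mulg_continuous (_, _) _ We.
  have [U1 [U1e U1W]] := IHs _ W1s; have [U2 [U2e U2W]] := IHu _ W2u.
  exists (fun v => U1 v `&` U2 v); split => [v|e' Ue']; first exact: filterI.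
  by apply: (W12 (_, _)); split; [apply: U1W|apply: U2W] => v; case: (Ue' v).
- have [U [Ue UW]] := IHs _ (invg_continuous _ _ We).
  by exists U; split => // e' /UW.
Qed.

(** * Homogeneous refinements *)

Section Homogeneous.
Context {R : realType} {G : topologicalGroupType} (polishG : polish R G).
Context {L : nat} {n : 'I_L -> nat} {I : 'I_L -> Type}.
Context (g : forall l : 'I_L, I l -> (n l).-tuple G).
Implicit Types (B : forall l, set (I l)) (phi : qf_formula (block_var n)).

Definition homogeneous B phi := exists t : bool,
  forall alpha : (forall l, I l), (forall l, B l (alpha l)) ->
    satisfies (block_val (fun l => g l (alpha l))) (fsign phi t).

Lemma homogeneousS {B B' phi} :
  (forall l, B' l `<=` B l) -> homogeneous B phi -> homogeneous B' phi.
Proof.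
by move=> B'B [t Bt]; exists t => alpha B'a; apply: Bt => l; apply: B'B.
Qed.

(** Allowing every uncountable family [B] as a start lets refinements be iterated. *)
Definition refinable phi := forall B, (forall l, ~ countable (B l)) ->
  exists B', [/\ forall l, B' l `<=` B l, forall l, ~ countable (B' l) &
                 homogeneous B' phi].

Lemma refinable_eq (s u : group_term (block_var n)) : refinable (FEq s u).
Proof.
move=> B ucB.
have [sepG [d [dmet dG _]]] := polishG.
have [b bP] := separable_metric_base dmet dG sepG.
(* [S l c] collects the indices whose tuple lies in the basic box coded by [c]; these codes form a
   countable type. *)
pose S l (c : {ffun 'I_(n l) -> nat}) :=
  [set x : I l | forall i, b (c i) (tnth (g l x) i)].
pose C l := [set x | B l x /\ forall c, S l c x -> ~ countable (B l `&` S l c)].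
have ucC l : ~ countable (C l) := uncountable_condensation (@S l) (ucB l).
have [su|/existsNP[alpha]] := pselect (forall alpha : (forall l, I l),
    (forall l, C l (alpha l)) ->
    satisfies (block_val (fun l => g l (alpha l))) (FEq s u)).
  by exists C; split => [l x []||] //; exists true.
move/not_implyP => [Ca /= su]; set e := block_val _ in su.
have [Ws [Wu [sWs uWu Wsu]]] := metric_separation dmet dG su.
have [Us [Use UsW]] := term_val_box sWs.
have [Uu [Uue UuW]] := term_val_box uWu.
(* One basic set per variable controls both terms, keeping their values in the disjoint sets [Ws]
   and [Wu]. *)
have /choice[k kP] (v : block_var n) :
    exists k, b k (e v) /\ b k `<=` Us v `&` Uu v.
  by apply: bP; exact: filterI.
pose c l := [ffun i : 'I_(n l) => k (Tagged (fun l => 'I_(n l)) i)].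
exists (fun l => B l `&` S l (c l)); split => [l x []//|l|].
  (* The index [alpha l] is a condensation index in this trace, so the trace is uncountable. *)
  apply: (Ca l).2 => i; rewrite ffunE.
  by have [] := kP (Tagged (fun l => 'I_(n l)) i).
exists false => beta Bb /= sub.
have Ub v : (Us v `&` Uu v) (block_val (fun l => g l (beta l)) v).
  have [_] := kP v; apply; case: v => l i.
  by have [_ /(_ i)] := Bb l; rewrite ffunE.
apply: (Wsu (term_val (block_val (fun l => g l (beta l))) s)).
  by apply: UsW => v; case: (Ub v).
by rewrite sub; apply: UuW => v; case: (Ub v).
Qed.

(** Refine for [phi], then for [psi]; the first homogeneity passes to subsets. *)
Lemma refinable2 {phi psi chi} :
  (forall B, homogeneous B phi -> homogeneous B psi -> homogeneous B chi) ->
  refinable phi -> refinable psi -> refinable chi.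
Proof.
move=> hom rphi rpsi B /rphi[B1 [B1B uc1 h1]].
have [B2 [B21 uc2 h2]] := rpsi _ uc1; exists B2; split => //.
  by move=> l; apply: subset_trans (B1B l).
by apply: hom => //; apply: homogeneousS h1.
Qed.

Lemma refinable_formula phi : refinable phi.
Proof.
elim: phi => [s u|p IHp|p IHp q IHq|p IHp q IHq|p IHp q IHq].
- exact: refinable_eq.
- apply: (refinable2 _ IHp IHp) => B [t Bt] _; exists (~~ t) => a /Bt.
  by case: t {Bt} => //= ? ?.
- apply: refinable2 IHp IHq => B [t Bt] [t' Bt']; exists (t && t') => a Ba.
  by move: (Bt a Ba) (Bt' a Ba); case: t {Bt}; case: t' {Bt'} => //=; tauto.
- apply: refinable2 IHp IHq => B [t Bt] [t' Bt']; exists (t || t') => a Ba.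
  by move: (Bt a Ba) (Bt' a Ba); case: t {Bt}; case: t' {Bt'} => //=; tauto.
- apply: refinable2 IHp IHq => B [t Bt] [t' Bt']; exists (t ==> t') => a Ba.
  by move: (Bt a Ba) (Bt' a Ba); case: t {Bt}; case: t' {Bt'} => //=; tauto.
Qed.

Lemma finite_refinement {Delta : set (qf_formula (block_var n))} B :
  finite_set Delta -> (forall l, ~ countable (B l)) ->
  exists B', [/\ forall l, B' l `<=` B l, forall l, ~ countable (B' l) &
                 forall phi, Delta phi -> homogeneous B' phi].
Proof.
(* [classic] equips formulas with decidable equality, so that [Delta] can be listed and treated one
   formula at a time. *)
move/(@finite_seqP {classic qf_formula (block_var n)}) => [s ->] {Delta}.
elim: s B => [|phi s IHs] B ucB; first by exists B; split => // phi.
have [B1 [B1B uc1 h1]] := IHs _ ucB.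
have [B2 [B21 uc2 h2]] := refinable_formula phi _ uc1.
exists B2; split => // [l|psi /=]; first exact: subset_trans (B1B l).
by rewrite inE => /predU1P[->//|/h1]; apply: homogeneousS.
Qed.

End Homogeneous.

Theorem theorem2p1 (R : realType) (G : topologicalGroupType)
    (polishG : polish R G)
    (L : nat) (n : 'I_L -> nat) (A : 'I_L -> set omega1)
    (A_aleph1 : forall l : 'I_L, aleph1_subsets [set: omega1] (A l))
    (g : forall l : 'I_L, A l -> (n l).-tuple G)
    (Delta : set (qf_formula (block_var n)))
    (finDelta : finite_set Delta) :
  exists (B : 'I_L -> set omega1) (t : qf_formula (block_var n) -> bool),
    (forall l : 'I_L, aleph1_subsets (A l) (B l)) /\
    forall phi : qf_formula (block_var n), Delta phi ->
    forall alpha : (forall l : 'I_L, A l),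
      (forall l : 'I_L, B l (\val (alpha l))) ->
      satisfies (block_val (fun l : 'I_L => g l (alpha l)))
        (fsign phi (t phi)).
Proof.
(* Since [g l] is defined only on [A l], the refinement takes place inside the type [A l], starting
   from its full set. *)
have [l|B [_ ucB hB]] :=
    finite_refinement polishG g (fun l => [set: A l]) finDelta.
  have [_ uncountable_omega1 _] := omega1_spec.
  apply: (contra_not _ uncountable_omega1) => cT.
  have [_ Aw] := A_aleph1 l; rewrite -(eq_countable Aw).
  by rewrite -(eq_countable (card_setT _)).
have inj_val l : injective (@set_val _ (A l)) by exact: val_inj.
(* The truth value records whether [phi] holds throughout [B]; for [phi] in [Delta], homogeneity
   makes its failure uniform. *)
exists (fun l => set_val @` B l), (fun phi => `[<
  forall alpha : (forall l, A l), (forall l, B l (alpha l)) ->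
  satisfies (block_val (fun l => g l (alpha l))) phi >]).
split => [l|phi Dphi alpha Ba].
  split => [_ [x _ <-]|]; first exact: set_valP.
  apply: uncountable_omega1_card => cB; apply: (ucB l).
  by rewrite -(eq_countable (inj_card_eq (in2W (@inj_val l)))).
have {}Ba l : B l (alpha l) by have [x Bx /inj_val <-] := Ba l.
case: asboolP => [sat|nsat]; first exact: sat.
have [[] Bt] := hB _ Dphi; first by case: nsat.
exact: Bt.
Qed.
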